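(* Let $\mathcal E$ be a quantum channel on $n$ qubits. There exists a quantum channel $\mathcal E'$ with $\mathcal E'\mathcal M_{\mathbb Z}=\mathcal M_{\mathbb Z}\mathcal E$ (i.e. classical noise inversion is valid for $\mathcal E$) if and only if $$\langle\langle\sigma|\mathcal E|\nu\rangle\rangle=0\qquad\text{for all }\sigma\in\mathbb Z\text{ and all Pauli operators }\nu\notin\mathbb Z.$$
   Context: For operators on $(\mathbb C^2)^{\otimes n}$, $\langle\langle A|\mathcal E|B\rangle\rangle=\operatorname{Tr}(A^\dagger\mathcal E(B))$, and juxtaposition of maps is composition. Pauli operators means the sign-free $n$-qubit Pauli operators $\{I,X,Y,Z\}^{\otimes n}$ (normalized by $1/\sqrt{2^n}$ to form an orthonormal basis for the Hilbert–Schmidt inner product), and $\mathbb Z=\{I,Z\}^{\otimes n}$ is the subset of sign-free Pauli-$Z$ operators (with the same normalization). $\mathcal M_{\mathbb Z}=\sum_{b\in\{0,1\}^n}|b\rangle\rangle\langle\langle b|=\sum_{\sigma\in\mathbb Z}|\sigma\rangle\rangle\langle\langle\sigma|$ is the computational-basis measurement (completely dephasing) channel, where $|b\rangle\rangle$ is the vectorization of $|b\rangle\langle b|$. By definition, classical noise inversion (CNI) is valid for the noise $\mathcal E$ iff the noise can propagate through the computational-basis measurement, i.e. iff there exists a channel $\mathcal E'$ with $\mathcal E'\mathcal M_{\mathbb Z}=\mathcal M_{\mathbb Z}\mathcal E$. *)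

(* Defs.v *)
(* Operators on (C^2)^{(x) n} are 'M[R[i]]_(2 ^ n) with
   R : realType, so that R[i] is the field of complex numbers. *)
From HB Require Import structures.
From mathcomp Require Import all_boot all_order all_algebra.
From mathcomp Require Export sesquilinear mxtens complex.
From mathcomp Require Import classical_sets reals.

Set Implicit Arguments.
Unset Strict Implicit.
Unset Printing Implicit Defensive.

Import Order.TTheory GRing.Theory Num.Theory.
Local Open Scope ring_scope.
Local Open Scope classical_set_scope.
Local Open Scope sesquilinear_scope.

Section Channels.
Variable C : numClosedFieldType.

Definition adjmx m n (A : 'M[C]_(m, n)) : 'M[C]_(n, m) := A ^t Num.conj.

(* The order of C makes [0 <= z] mean "z is real and nonnegative"; hence a
   positive semidefinite matrix is automatically Hermitian. *)
Definition psdmx d (A : 'M[C]_d) : Prop :=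
  forall v : 'cV[C]_d, 0 <= (adjmx v *m A *m v) 0 0.

Definition tens_block k d (X : 'M[C]_(k * d)) (i j : 'I_k) : 'M[C]_d :=
  \matrix_(a, b) X (mxtens_index (i, a)) (mxtens_index (j, b)).

(* id_k (x) E, computed from X = \sum_(i, j) |i><j| (x) X_ij. *)
Definition ampliation k d (E : 'M[C]_d -> 'M[C]_d) (X : 'M[C]_(k * d)) :
    'M[C]_(k * d) :=
  \sum_(i < k) \sum_(j < k) (delta_mx i j *t E (tens_block X i j)).

Definition completely_positive d (E : 'M[C]_d -> 'M[C]_d) : Prop :=
  forall (k : nat) (X : 'M[C]_(k * d)), psdmx X -> psdmx (ampliation E X).

Definition trace_preserving d (E : 'M[C]_d -> 'M[C]_d) : Prop :=
  forall X : 'M[C]_d, \tr (E X) = \tr X.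

Definition quantum_channel d (E : {linear 'M[C]_d -> 'M[C]_d}) : Prop :=
  completely_positive E /\ trace_preserving E.

(* <<A|B>> *)
Definition hs_inner d (A B : 'M[C]_d) : C := \tr (adjmx A *m B).

(* <<A|E|B>> *)
Definition hs_elem d (A : 'M[C]_d) (E : 'M[C]_d -> 'M[C]_d) (B : 'M[C]_d) : C :=
  hs_inner A (E B).

(* |A>><<B| *)
Definition hs_outer d (A B : 'M[C]_d) (X : 'M[C]_d) : 'M[C]_d :=
  hs_inner B X *: A.

Inductive pauli_label := PauliI | PauliX | PauliY | PauliZ.

Definition pauli1 (p : pauli_label) : 'M[C]_2 :=
  match p with
  | PauliI => 1%:M
  | PauliX => delta_mx 0 1 + delta_mx 1 0
  | PauliY => - 'i *: delta_mx 0 1 + 'i *: delta_mx 1 0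
  | PauliZ => delta_mx 0 0 - delta_mx 1 1
  end.

(* A_0 (x) ... (x) A_(n-1) *)
Fixpoint qubit_tensor (n : nat) : ('I_n -> 'M[C]_2) -> 'M[C]_(2 ^ n) :=
  match n with
  | 0 => fun _ => 1%:M
  | n'.+1 => fun A =>
      castmx (esym (expnS 2 n'), esym (expnS 2 n'))
        (A ord0 *t qubit_tensor (fun i => A (lift ord0 i)))
  end.

Definition pauli_string n (s : 'I_n -> pauli_label) : 'M[C]_(2 ^ n) :=
  (sqrtC (2 ^ n)%:R)^-1 *: qubit_tensor (fun i => pauli1 (s i)).

Definition pauli_ops n : set 'M[C]_(2 ^ n) :=
  [set pauli_string s | s in [set: 'I_n -> pauli_label]].

Definition pauliZ_ops n : set 'M[C]_(2 ^ n) :=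
  [set pauli_string s | s in
     [set s : 'I_n -> pauli_label | forall i, s i = PauliI \/ s i = PauliZ]].

(* The computational basis vector |b>, b in {0,1}^n, is the standard basis
   vector of C^(2^n) whose index in 'I_(2 ^ n) has binary expansion b, most
   significant bit first; so |b><b| is [delta_mx b b].  This is the ordering
   of mxtens_index, hence of qubit_tensor. *)
Definition Zmeasurement n (X : 'M[C]_(2 ^ n)) : 'M[C]_(2 ^ n) :=
  \sum_(b < 2 ^ n) hs_outer (delta_mx b b) (delta_mx b b) X.

End Channels.

Arguments pauli_ops {C} n.
Arguments pauliZ_ops {C} n.
Arguments Zmeasurement {C} n.

(* Main.v *)
(* Write D for the dephasing channel.  If [E' D = D E], then
   [<<sigma|E|nu>> = <<sigma|D E|nu>> = <<sigma|E' D|nu>> = 0], as sigma is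
   diagonal and nu has zero diagonal.  Conversely [E' := D E] works: the Z
   strings span the diagonal matrices and the other Pauli strings the matrices
   with zero diagonal, so the hypothesis says that [D E] kills the latter, that
   is [D E = D E D]. *)
Require Import Defs.
From HB Require Import structures.
From mathcomp Require Import all_boot all_order all_algebra.
From mathcomp Require Import classical_sets reals.
From mathcomp Require Import ring.

Import Order.TTheory GRing.Theory Num.Theory.
Local Open Scope ring_scope.

(** * Pauli strings: expansion of matrix units and positions of nonzero entries *)

Section PauliStrings.
Set Implicit Arguments.
Unset Strict Implicit.
Variable C : numClosedFieldType.

Definition is_IZ (p : pauli_label) : bool :=
  match p with PauliI | PauliZ => true | _ => false end.

Definition Zstring n (s : 'I_n -> pauli_label) : bool :=
  [forall i, is_IZ (s i)].

(** Unnormalized strings, which keep the factor [1/sqrt(2^n)] out of the inductions on [n]. *)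
Definition pauli_tensor n (s : 'I_n -> pauli_label) : 'M[C]_(2 ^ n) :=
  qubit_tensor (fun i => pauli1 C (s i)).

Lemma is_IZP p : reflect (p = PauliI \/ p = PauliZ) (is_IZ p).
Proof. by case: p => /=; constructor; auto; case. Qed.

Lemma ZstringP n (s : 'I_n -> pauli_label) :
  reflect (forall i, s i = PauliI \/ s i = PauliZ) (Zstring s).
Proof. by apply: (iffP forallP) => sZ i; apply/is_IZP. Qed.

Lemma ZstringS n (s : 'I_n.+1 -> pauli_label) :
  Zstring s = is_IZ (s ord0) && Zstring (fun i => s (lift ord0 i)).
Proof.
apply/forallP/andP => [sZ|[s0 /forallP sZ] i].
  by split; last apply/forallP.
by case: (unliftP ord0 i) => [j|] ->.
Qed.

Definition scons n (p : pauli_label) (s : 'I_n -> pauli_label) (i : 'I_n.+1) :=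
  if unlift ord0 i is Some j then s j else p.

Lemma eq_qubit_tensor n (A B : 'I_n -> 'M[C]_2) :
  A =1 B -> qubit_tensor A = qubit_tensor B.
Proof.
elim: n A B => [//|n IHn] A B eqAB /=.
by rewrite eqAB (IHn _ (fun i => B (lift ord0 i))).
Qed.

Lemma pauli_tensor_scons n p (s : 'I_n -> pauli_label) :
  pauli_tensor (scons p s) =
  castmx (esym (expnS 2 n), esym (expnS 2 n)) (pauli1 C p *t pauli_tensor s).
Proof.
rewrite /pauli_tensor /= {1}/scons unlift_none; congr (castmx _ (_ *t _)).
by apply: eq_qubit_tensor => i; rewrite /scons liftK.
Qed.

Lemma Zstring_scons n p (s : 'I_n -> pauli_label) :
  Zstring (scons p s) = is_IZ p && Zstring s.
Proof.
rewrite ZstringS /scons unlift_none; congr andb.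
by apply: eq_forallb => i; rewrite liftK.
Qed.

(** Spanning is phrased as an induction principle over such predicates. Once some [P A] holds,
    [c = -1] gives [P 0]. *)
Definition lin_closed m (P : 'M[C]_m -> Prop) :=
  forall c A B, P A -> P B -> P (c *: A + B).

(** The four matrix units are [(I + Z)/2], [(X + iY)/2], [(X - iY)/2] and [(I - Z)/2]. *)
Lemma pauli1_span (P : 'M[C]_2 -> Prop) (a b : 'I_2) : lin_closed P ->
  (forall p, is_IZ p = (a == b) -> P (pauli1 C p)) -> P (delta_mx a b).
Proof.
move=> linP.
have linPZ p c : P (pauli1 C p) -> P (c *: pauli1 C p).
  (* Here [c A] is obtained as [(c - 1) A + A]. *)
  move=> Pp; have := linP (c - 1) _ _ Pp Pp.
  by rewrite scalerBl scale1r subrK.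
have i2 : 'i * 'i = -1 :> C by rewrite -expr2 sqrCi.
have tr2 (c : C) p q M : P (pauli1 C p) -> P (pauli1 C q) ->
    2^-1 *: pauli1 C p + (2^-1 * c) *: pauli1 C q = M -> P M.
  by move=> Pp Pq <-; apply: linP => //; apply: linPZ.
have ord2 (i : 'I_2) : i = 0 \/ i = 1.
  by case: i => -[|[|//]] ?; [left|right]; apply: val_inj.
case: (ord2 a) (ord2 b) => -> [] -> /= PP;
  [apply: (tr2 1 PauliI PauliZ) | apply: (tr2 'i PauliX PauliY)
  | apply: (tr2 (- 'i) PauliX PauliY) | apply: (tr2 (-1) PauliI PauliZ)];
  try exact: PP; apply/matrixP => i j;
  by case: (ord2 i) (ord2 j) => -> [] ->; rewrite !mxE /=; field: i2.
Qed.

(* Prescribing [Zstring s] through [a == b] treats diagonal and off-diagonal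
   matrix units in a single induction. *)
Lemma pauli_span n (P : 'M[C]_(2 ^ n) -> Prop) (a b : 'I_(2 ^ n)) :
  lin_closed P ->
  (forall s, Zstring s = (a == b) -> P (pauli_tensor s)) -> P (delta_mx a b).
Proof.
elim: n P a b => [|n IHn] P a b linP PP.
  have -> : delta_mx a b = pauli_tensor (fun i : 'I_0 => PauliI).
    by apply/matrixP => i j; rewrite !mxE !ord1 !eqxx.
  by apply: PP; rewrite !ord1 eqxx; apply/forallP => -[].
have {}PP p s : is_IZ p && Zstring s = (a == b) ->
    P (castmx (esym (expnS 2 n), esym (expnS 2 n)) (pauli1 C p *t pauli_tensor s)).
  by rewrite -pauli_tensor_scons -Zstring_scons; apply: PP.
(* Eliminating the equation [e] turns the dimension into [2 * 2 ^ n]: the cast disappears and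
   indices split into pairs. *)
move: (esym (expnS 2 n)) PP => e.
move: P a b linP; case: _ / e => P a b linP PP.
have {}PP p s : is_IZ p && Zstring s = (a == b) ->
  P (pauli1 C p *t pauli_tensor s) by move/PP; rewrite castmx_id.
case: (mxtens_indexP a) (mxtens_indexP b) PP => a0 a1 [b0 b1] PP.
have eqi : (mxtens_index (a0, a1) == mxtens_index (b0, b1)) =
    (a0 == b0) && (a1 == b1).
  by rewrite (can_eq (@mxtens_indexK _ _)) xpair_eqE.
have -> : delta_mx (mxtens_index (a0, a1)) (mxtens_index (b0, b1)) =
    delta_mx a0 b0 *t delta_mx a1 b1 :> 'M[C]_(2 * 2 ^ n).
  apply/matrixP => i j.
  case: (mxtens_indexP i) (mxtens_indexP j) => i0 i1 [j0 j1].
  rewrite tensmxE !mxE !(can_eq (@mxtens_indexK _ _)) !xpair_eqE -natrM mulnb.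
  by congr (nat_of_bool _)%:R; rewrite !andbA; congr andb; rewrite andbAC.
(* The tensor product is linear in each factor: the left unit is expanded first, then the right one
   by induction. *)
apply: (@pauli1_span (fun A => P (A *t delta_mx a1 b1))).
  move=> c A B PA PB; have := linP c _ _ PA PB; congr P.
  apply/matrixP => i j; case: (mxtens_indexP i) (mxtens_indexP j) => i0 i1 [j0 j1].
  by rewrite mxE [in X in _ + X]tensmxE mxE !tensmxE !mxE mulrDl mulrA.
move=> p pZ; apply: (IHn (fun A => P (pauli1 C p *t A))).
  move=> c A B PA PB; have := linP c _ _ PA PB; congr P.
  apply/matrixP => i j; case: (mxtens_indexP i) (mxtens_indexP j) => i0 i1 [j0 j1].
  by rewrite mxE [in X in _ + X]tensmxE mxE !tensmxE !mxE mulrDr mulrCA.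
by move=> s sZ; apply: PP; rewrite eqi pZ sZ.
Qed.

(** Removes the cast of [qubit_tensor]; [P] ranges over all dimensions so that the equation between
    the two can be eliminated. *)
Lemma pauli_tensorS n (s : 'I_n.+1 -> pauli_label)
    (P : forall m, 'M[C]_m -> Prop) :
  P _ (pauli1 C (s ord0) *t pauli_tensor (fun i => s (lift ord0 i))) ->
  P _ (pauli_tensor s).
Proof.
rewrite {2}/pauli_tensor /=; move: (esym (expnS 2 n)) => e.
by case: _ / e; rewrite castmx_id.
Qed.

(** A diagonal entry is a product of diagonal entries of the factors, which are [1] or [-1] for I
    and Z, and [0] for X and Y. *)
Lemma pauli_tensor_diag n (s : 'I_n -> pauli_label) a :
  (pauli_tensor s a a != 0) = Zstring s.
Proof.
elim: n s a => [|n IHn] s a.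
  rewrite mxE !ord1 eqxx oner_eq0; symmetry; by apply/forallP => -[].
move: a; apply: (@pauli_tensorS n s (fun m M => forall a, (M a a != 0) = Zstring s)) => a.
case: (mxtens_indexP a) => a0 a1; rewrite tensmxE mulf_eq0 negb_or IHn ZstringS.
congr andb; case: (s ord0); case: a0 => -[|[|//]] a0 /=;
  by rewrite !mxE /= ?(mulr0, subr0, sub0r, addr0) ?oppr_eq0 ?oner_eq0 ?eqxx.
Qed.

(** Distinct indices differ in some qubit, where the diagonal factor contributes [0]. *)
Lemma Zstring_offdiag n (s : 'I_n -> pauli_label) a b :
  Zstring s -> a != b -> pauli_tensor s a b = 0.
Proof.
elim: n s a b => [|n IHn] s a b; first by rewrite !ord1 eqxx.
move=> sZ; move: a b.
apply: (@pauli_tensorS n s (fun m M => forall a b, a != b -> M a b = 0)) => a b.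
case: (mxtens_indexP a) (mxtens_indexP b) => a0 a1 [b0 b1].
rewrite (can_eq (@mxtens_indexK _ _)) xpair_eqE negb_and tensmxE.
move: sZ; rewrite ZstringS => /andP[s0 sZ] /orP[ne|ne]; last first.
  by rewrite IHn // mulr0.
suff -> : pauli1 C (s ord0) a0 b0 = 0 by rewrite mul0r.
by case: (s ord0) s0 => // _; case: a0 b0 ne => -[|[|//]] ? [] [|[|//]] ? // _;
  rewrite !mxE /= ?subrr.
Qed.

Lemma pauli_stringE n (s : 'I_n -> pauli_label) :
  pauli_string C s = (sqrtC (2 ^ n)%:R)^-1 *: pauli_tensor s.
Proof. by []. Qed.

Lemma pauli_norm_neq0 n : (sqrtC (2 ^ n)%:R)^-1 != 0 :> C.
Proof. by rewrite invr_eq0 sqrtC_eq0 pnatr_eq0 expn_eq0. Qed.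

(** Membership concerns the matrix and not its label, but any one diagonal entry of the matrix
    decides [Zstring]. *)
Lemma pauliZ_string n (s : 'I_n -> pauli_label) :
  pauliZ_ops n (pauli_string C s) <-> Zstring s.
Proof.
split=> [[t /ZstringP tZ eq_ts]|/ZstringP sZ]; last by exists s.
have x : 'I_(2 ^ n) by exists 0%N; rewrite expn_gt0.
move: eq_ts; rewrite !pauli_stringE => /(scalerI (pauli_norm_neq0 n)) eq_ts.
by rewrite -(pauli_tensor_diag s x) -eq_ts pauli_tensor_diag.
Qed.

End PauliStrings.

(** * The Hilbert-Schmidt product and the dephasing channel *)

Section Dephasing.
Set Implicit Arguments.
Unset Strict Implicit.
Variable C : numClosedFieldType.

(** As [hs_inner] is antilinear on the left, this swap moves a matrix to be expanded into the linear
    slot. *)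
Lemma hs_inner_conj d (A B : 'M[C]_d) : hs_inner A B = Num.conj (hs_inner B A).
Proof.
rewrite /hs_inner /adjmx -(@trace_map_mx _ _ Num.conj) -mxtrace_tr.
rewrite map_mxM trmx_mul /=; congr (\tr (_ *m _)).
  by apply/matrixP => i j; rewrite !mxE conjCK.
by apply/matrixP => i j; rewrite !mxE.
Qed.

Lemma hs_inner_linear d (A : 'M[C]_d) c (B B' : 'M[C]_d) :
  hs_inner A (c *: B + B') = c * hs_inner A B + hs_inner A B'.
Proof. by rewrite /hs_inner mulmxDr -scalemxAr mxtraceD mxtraceZ. Qed.

Lemma hs_innerZ d a b (A B : 'M[C]_d) :
  hs_inner (a *: A) (b *: B) = Num.conj a * b * hs_inner A B.
Proof.
have -> : hs_inner (a *: A) (b *: B) = \tr ((Num.conj a *: adjmx A) *m (b *: B)).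
  by congr (\tr (_ *m _)); apply/matrixP => i j; rewrite !mxE rmorphM.
by rewrite -scalemxAl -scalemxAr !mxtraceZ mulrA.
Qed.

Lemma hs_inner_delta d (A : 'M[C]_d) a b : hs_inner (delta_mx a b) A = A a b.
Proof.
rewrite /hs_inner /mxtrace (bigD1 b) //= big1 ?addr0 => [|i ib].
  rewrite mxE (bigD1 a) //= big1 => [|j ja].
    by rewrite !mxE !eqxx conjC1 mul1r addr0.
  by rewrite !mxE (negPf ja) conjC0 mul0r.
by rewrite mxE big1 // => j _; rewrite !mxE (negPf ib) andbF conjC0 mul0r.
Qed.

Lemma ZmeasurementE n (X : 'M[C]_(2 ^ n)) a b :
  Zmeasurement n X a b = if a == b then X a a else 0.
Proof.
rewrite /Zmeasurement summxE (bigD1 a) //= big1 ?addr0 => [|i ia].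
  by rewrite !mxE eqxx hs_inner_delta eq_sym; case: eqP; rewrite ?mulr1 ?mulr0.
by rewrite !mxE eq_sym (negPf ia) mulr0.
Qed.

Lemma Zmeasurement_linear n : linear (@Zmeasurement C n).
Proof.
move=> c X Y; apply/matrixP => a b; rewrite ZmeasurementE !mxE !ZmeasurementE.
by case: ifP; rewrite ?mxE // mulr0 addr0.
Qed.

(** Makes [Zmeasurement n \o E] a [{linear _ -> _}] map, as the witness [E'] must be. *)
HB.instance Definition _ n :=
  GRing.isLinear.Build C 'M[C]_(2 ^ n) 'M[C]_(2 ^ n) _ (@Zmeasurement C n)
    (@Zmeasurement_linear n).

(** * Blocks of the ampliation and complete positivity *)

Lemma ampliationE k d (E : 'M[C]_d -> 'M[C]_d) (X : 'M[C]_(k * d)) i j a b :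
  ampliation E X (mxtens_index (i, a)) (mxtens_index (j, b)) =
  E (tens_block X i j) a b.
Proof.
rewrite /ampliation summxE (bigD1 i) //= [X in _ + X]big1 ?addr0 => [|i' ii'].
  rewrite summxE (bigD1 j) //= big1 ?addr0 => [|j' jj'].
    by rewrite tensmxE mxE !eqxx mul1r.
  by rewrite tensmxE mxE [j == _]eq_sym (negPf jj') andbF mul0r.
rewrite summxE big1 // => j' _.
by rewrite tensmxE mxE [i == _]eq_sym (negPf ii') mul0r.
Qed.

Lemma ampliation_comp k d (E F : 'M[C]_d -> 'M[C]_d) (X : 'M[C]_(k * d)) :
  ampliation (F \o E) X = ampliation F (ampliation E X).
Proof.
apply/matrixP => i j; case: (mxtens_indexP i) (mxtens_indexP j) => i0 i1 [j0 j1].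
rewrite !ampliationE /=; congr (F _ _ _).
by apply/matrixP => a b; rewrite mxE ampliationE.
Qed.

Lemma completely_positive_comp d (E F : 'M[C]_d -> 'M[C]_d) :
  completely_positive E -> completely_positive F ->
  completely_positive (F \o E).
Proof. by move=> cpE cpF k X pX; rewrite ampliation_comp; apply/cpF/cpE. Qed.

(* Kraus form: the ampliation is [X |-> \sum_c P_c X P_c] with
   [P_c = 1 (x) |c><c|]. *)
Lemma Zmeasurement_cp n : completely_positive (@Zmeasurement C n).
Proof.
move=> k X pX v.
pose P (c : 'I_(2 ^ n)) : 'M[C]_(k * 2 ^ n) :=
  diag_mx (\row_i ((mxtens_unindex i).2 == c)%:R).
have PT c : adjmx (P c) = P c.
  apply/matrixP => i j; rewrite !mxE [j == i]eq_sym.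
  by case: (i =P j) => [->|_]; rewrite ?mulr1n ?mulr0n ?conjC0 // conjC_nat.
have -> : ampliation (Zmeasurement n) X = \sum_c adjmx (P c) *m X *m P c.
  apply/matrixP => i j; case: (mxtens_indexP i) (mxtens_indexP j) => i0 i1 [j0 j1].
  rewrite ampliationE ZmeasurementE summxE (bigD1 i1) //= big1 ?addr0 => [|c ci].
    rewrite PT mul_diag_mx mul_mx_diag !mxE !mxtens_indexK /= eqxx mul1r eq_sym.
    by case: eqP => [->|_]; rewrite ?mulr1 ?mulr0.
  rewrite PT mul_diag_mx mul_mx_diag !mxE !mxtens_indexK /= eq_sym (negPf ci).
  by rewrite !mul0r.
rewrite mulmx_sumr mulmx_suml summxE; apply: sumr_ge0 => c _.
(* Each Kraus term is the quadratic form of [X] at [P c *m v]. *)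
have := pX (P c *m v); congr (0 <= _ _ _).
by rewrite /adjmx trmx_mul map_mxM !mulmxA.
Qed.

Lemma Zmeasurement_tp n : trace_preserving (@Zmeasurement C n).
Proof. by move=> X; apply: eq_bigr => a _; rewrite ZmeasurementE eqxx. Qed.

(** A diagonal [A] pairs only with the diagonal of [X], which dephasing preserves. *)
Lemma hs_inner_Zmeasurement n (A X : 'M[C]_(2 ^ n)) :
  (forall a b, a != b -> A a b = 0) ->
  hs_inner A X = hs_inner A (Zmeasurement n X).
Proof.
move=> dA; apply: eq_bigr => a _; rewrite !mxE; apply: eq_bigr => b _.
rewrite ZmeasurementE !mxE; case: eqP => [->//|/eqP ba].
by rewrite dA // conjC0 !mul0r.
Qed.

(** On matrix units: dephasing fixes the diagonal ones and kills the others, which [D E] kills by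
    hypothesis. *)
Lemma Zmeasurement_offdiag n (E : {linear 'M[C]_(2 ^ n) -> 'M[C]_(2 ^ n)}) :
  (forall a b, a != b -> Zmeasurement n (E (delta_mx a b)) = 0) ->
  Zmeasurement n \o E \o Zmeasurement n =1 Zmeasurement n \o E.
Proof.
move=> killE X /=; rewrite [X in RHS]matrix_sum_delta.
rewrite [Zmeasurement n X]matrix_sum_delta !linear_sum.
apply: eq_bigr => a _; rewrite !linear_sum; apply: eq_bigr => b _.
rewrite !linearZ /= ZmeasurementE; case: eqP => [->//|/eqP ab].
by rewrite killE // !scaler0.
Qed.

(** Only the entries [<<cc|E|ab>>] matter; [pauli_span] is applied once in each slot, to Z strings
    for [cc] and to the other strings for [ab]. *)
Lemma Zmeasurement_kill n (E : {linear 'M[C]_(2 ^ n) -> 'M[C]_(2 ^ n)}) :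
  (forall s t : 'I_n -> pauli_label, Zstring s -> ~~ Zstring t ->
    hs_inner (pauli_tensor C s) (E (pauli_tensor C t)) = 0) ->
  forall a b, a != b -> Zmeasurement n (E (delta_mx a b)) = 0.
Proof.
move=> orthE a b ab.
suff dE c : E (delta_mx a b) c c = 0.
  by apply/matrixP => i j; rewrite ZmeasurementE mxE dE if_same.
rewrite -hs_inner_delta hs_inner_conj.
apply/eqP; rewrite conjC_eq0; apply/eqP.
apply: (@pauli_span C n (fun A => hs_inner (E (delta_mx a b)) A = 0)).
  by move=> x A B eA eB; rewrite hs_inner_linear eA eB mulr0 addr0.
rewrite eqxx => s sZ; rewrite hs_inner_conj.
(* Swapped back, the product is linear in [delta_mx a b], ready for the second expansion. *)
apply/eqP; rewrite conjC_eq0; apply/eqP.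
apply: (@pauli_span C n (fun A => hs_inner (pauli_tensor C s) (E A) = 0)).
  by move=> x A B eA eB; rewrite linearP hs_inner_linear eA eB mulr0 addr0.
by rewrite (negPf ab) => t tZ; apply: orthE; rewrite ?tZ.
Qed.

End Dephasing.

Theorem proposition1 (R : realType) (n : nat)
    (E : {linear 'M[R[i]]_(2 ^ n) -> 'M[R[i]]_(2 ^ n)}) :
  quantum_channel E ->
  (exists E' : {linear 'M[R[i]]_(2 ^ n) -> 'M[R[i]]_(2 ^ n)},
      quantum_channel E' /\ E' \o Zmeasurement n =1 Zmeasurement n \o E)
  <->
  (forall sigma nu : 'M[R[i]]_(2 ^ n),
      pauliZ_ops n sigma -> pauli_ops n nu -> ~ pauliZ_ops n nu ->
      hs_elem sigma E nu = 0).
Proof.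
move=> [cpE tpE]; split.
  move=> [E' [_ commE]] _ _ [s /ZstringP sZ <-] [t _ <-] /pauliZ_string tZ.
  rewrite /hs_elem hs_inner_Zmeasurement; last first.
    by move=> a b ab; rewrite pauli_stringE mxE Zstring_offdiag ?mulr0.
  (* Folding the composite [D E] lets [commE] replace it by [E' D]. *)
  rewrite -[Zmeasurement n _]/((Zmeasurement n \o E) _) -commE /=.
  suff -> : Zmeasurement n (pauli_string R[i] t) = 0.
    by rewrite linear0 /hs_inner mulmx0 mxtrace0.
  apply/matrixP => a b; rewrite ZmeasurementE pauli_stringE !mxE.
  case: ifP => // _; rewrite -(pauli_tensor_diag R[i] t a) in tZ.
  by move/negP: tZ; rewrite negbK => /eqP ->; rewrite mulr0.
move=> orthE; exists (Zmeasurement n \o E).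
split; first split.
- exact: completely_positive_comp cpE (@Zmeasurement_cp _ n).
- by move=> X /=; rewrite Zmeasurement_tp tpE.
(* What remains is [D E D = D E], reduced to pairs of unnormalized strings. *)
apply/Zmeasurement_offdiag/Zmeasurement_kill => s t sZ tZ.
have := orthE (pauli_string _ s) (pauli_string _ t).
move=> /(_ (proj2 (pauliZ_string _ s) sZ) (ex_intro2 _ _ t I erefl)).
case/(_ (fun tZ' => negP tZ (proj1 (pauliZ_string _ t) tZ')))/eqP.
(* The nonzero normalizations of both strings cancel from the equation. *)
rewrite /hs_elem !pauli_stringE linearZ /= hs_innerZ.
by rewrite !mulf_eq0 conjC_eq0 (negPf (pauli_norm_neq0 _ n)) => /eqP.
Qed.
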